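(* Let $\mathbf{A}$ be an implicator groupoid. Then the following are equivalent: (1) $\mathbf{A} \models x'' \approx x$ and $\mathbf{A} \models x \land 0 \approx 0$; (2) $\mathbf{A} \models (0 \to x) \to y \approx y$; (3) $\mathbf{A}$ is a De Morgan algebra.
   Context: An implicator groupoid is an algebra $\mathbf A = \langle A, \to, 0 \rangle$, with $\to$ binary and $0$ a constant, which, writing $x' := x \to 0$, satisfies the identities (I) $(x \to y) \to z \approx [(z' \to x) \to (y \to z)']'$ and (I$_0$) $0'' \approx 0$. Put $x \land y := (x \to y')'$. Following the paper, an implicator groupoid is called a De Morgan algebra if it satisfies $(x \to y) \to x \approx x$. *)

(* Defs.v *)
From mathcomp Require Export all_boot.

Set Implicit Arguments.
Unset Strict Implicit.
Unset Printing Implicit Defensive.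

Declare Scope implicator_scope.
Delimit Scope implicator_scope with imp.

(* Algebras of type (2, 0); no identity is imposed at this level. *)
Record algebra : Type := Algebra {
  carrier :> Type;
  imp : carrier -> carrier -> carrier;
  zero : carrier
}.

Arguments imp {a} x y.
Arguments zero {a}.

Notation "x ~> y" := (imp x y)
  (at level 55, right associativity) : implicator_scope.
Notation "0" := zero : implicator_scope.

Local Open Scope implicator_scope.

Definition neg (A : algebra) (x : A) : A := x ~> 0.

Definition meet (A : algebra) (x y : A) : A := neg (x ~> neg y).

Notation "x /*\ y" := (meet x y)
  (at level 50, left associativity) : implicator_scope.

Definition implicator_groupoid (A : algebra) : Prop :=
  (forall x y z : A,
     (x ~> y) ~> z = neg ((neg z ~> x) ~> neg (y ~> z))) /\
  neg (neg (0 : A)) = 0.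

Definition de_morgan_algebra (A : algebra) : Prop :=
  implicator_groupoid A /\ (forall x y : A, (x ~> y) ~> x = x).

(* Main.v *)
Require Import Defs.

Set Implicit Arguments.
Unset Strict Implicit.
Unset Printing Implicit Defensive.

Local Open Scope implicator_scope.

(** Write [x'] for [neg x], and (I) for the identity
    [(x ~> y) ~> z = ((z' ~> x) ~> (y ~> z)')'].  Everything is obtained by
    putting [0] at well-chosen places of (I).

    Three facts do the work.  First, as soon as [x'' = x], instantiating (I) at
    [(x ~> 0) ~> 0] makes [0'] a left identity ([neg0_imp]).  Second, [x /*\ 0 = 0]
    then says that [0'] is the constant value of [x ~> 0'], and (I) at
    [(x ~> x) ~> 0'] turns this into [0 ~> x = 0']; so [0 ~> x] is a left
    identity, which is (2).  Third, under (2) or (3), (I) writes each element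
    as a negation of a term that collapses; this is what recovers [x'' = x].
    Once [x'' = x] is known, (2) yields [x' ~> x = x], and (I) reduces
    [(x ~> y) ~> x] to [(x ~> (y ~> x)')'], which is also the value that (I)
    gives to [(0 ~> y) ~> x = x].  Conversely, under (3) this last term equals
    [x]; the choices [y = 0] and [x = 0'] give the two identities of (1). *)

Lemma neg0_imp (A : algebra) (hA : implicator_groupoid A) :
  (forall x : A, neg (neg x) = x) -> forall x : A, neg 0 ~> x = x.
Proof.
move=> negK x; have [hI neg2_0] := hA.
have := hI x 0 0; rewrite -/(neg x) -/(neg (neg x)) negK => {2}->.
by rewrite -!/(neg 0) neg2_0 -/(neg (neg 0 ~> x)) negK.
Qed.

Lemma zero_imp_of_meet0 (A : algebra) (hA : implicator_groupoid A) :
  (forall x : A, neg (neg x) = x) -> (forall x : A, x /*\ 0 = 0) ->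
  forall x : A, 0 ~> x = neg 0.
Proof.
move=> negK meet0 x; have [hI _] := hA.
have imp_top (u : A) : u ~> neg 0 = neg 0.
  by have := meet0 u; rewrite /meet => /(congr1 (@neg A)); rewrite negK.
have := hI x x (neg 0); rewrite !imp_top negK.
by rewrite -[_ ~> 0]/(neg (0 ~> x)) negK.
Qed.

(** (I) at [(0 ~> y) ~> z], whose inner factor [z' ~> 0] is [z'']. *)
Lemma absorb_of_left_identity (A : algebra) (hA : implicator_groupoid A) :
  (forall x y : A, (0 ~> x) ~> y = y) ->
  forall y z : A, neg (neg (neg z) ~> neg (y ~> z)) = z.
Proof. by move=> h y z; have [hI _] := hA; have := hI 0 y z; rewrite h. Qed.

(** Since [0 ~> 0] is a left identity, (I) gives [y' = y''']; the preceding
    lemma shows that every element is a negation, so [y'' = y] follows. *)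
Lemma negK_of_left_identity (A : algebra) (hA : implicator_groupoid A) :
  (forall x y : A, (0 ~> x) ~> y = y) -> forall x : A, neg (neg x) = x.
Proof.
move=> h x; have [hI _] := hA.
have neg3 (y : A) : neg (neg (neg y)) = neg y.
  by have := hI (0 ~> 0) y 0; rewrite !h => /esym.
by rewrite -(absorb_of_left_identity hA h 0 x) neg3.
Qed.

Lemma de_morgan_of_left_identity (A : algebra) (hA : implicator_groupoid A) :
  (forall x y : A, (0 ~> x) ~> y = y) -> forall x y : A, (x ~> y) ~> x = x.
Proof.
move=> h x y; have [hI _] := hA.
have negK := negK_of_left_identity hA h.
have absorb (u z : A) : neg (z ~> neg (u ~> z)) = z.
  by have := absorb_of_left_identity hA h u z; rewrite negK.
have neg_imp : neg x ~> x = x.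
  (* Absorption of [x'] by the left identity [0 ~> 0]. *)
  have := absorb (0 ~> 0) (neg x); rewrite h negK.
  by move=> /(congr1 (@neg A)); rewrite !negK.
by rewrite hI neg_imp absorb.
Qed.

(** The case [y = 0] of [(x ~> y) ~> x = x] is [x' ~> x = x], which removes the
    first factor in the expansion of [(x ~> y) ~> x] by (I). *)
Lemma de_morgan_absorb (A : algebra) :
  de_morgan_algebra A -> forall x y : A, neg (x ~> neg (y ~> x)) = x.
Proof.
move=> [[hI _] h] x y.
by have := hI x y x; rewrite h [neg x ~> x]h.
Qed.

(** Here [(0 ~> x)' = 0] is itself an instance of [(x ~> y) ~> x = x], so
    absorption by [0] is double negation. *)
Lemma de_morgan_negK (A : algebra) :
  de_morgan_algebra A -> forall x : A, neg (neg x) = x.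
Proof.
move=> hD x; have [_ h] := hD.
by have := de_morgan_absorb hD x 0; rewrite [neg (0 ~> x)]h.
Qed.

Lemma de_morgan_meet0 (A : algebra) :
  de_morgan_algebra A -> forall x : A, x /*\ 0 = 0.
Proof.
move=> hD x; have [hA _] := hD; have negK := de_morgan_negK hD.
(* In [0' = (0' ~> (x ~> 0')')'] the left identity [0'] can be dropped. *)
have := de_morgan_absorb hD (neg 0) x.
by rewrite (neg0_imp hA negK) negK /meet => ->; rewrite negK.
Qed.

Theorem theorem6p5 (A : algebra) (hA : implicator_groupoid A) :
  [<-> (forall x : A, neg (neg x) = x) /\ (forall x : A, x /*\ 0 = 0);
       forall x y : A, (0 ~> x) ~> y = y;
       de_morgan_algebra A].
Proof.
tfae.
- move=> [negK meet0] x y.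
  by rewrite (zero_imp_of_meet0 hA negK meet0) (neg0_imp hA negK).
- by move=> h; split=> //; apply: de_morgan_of_left_identity.
- by move=> hD; split; [apply: de_morgan_negK | apply: de_morgan_meet0].
Qed.
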